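(* Let $(X,\rho)$ be a Hadamard space, let $K\subset X$ be nonempty, closed and convex, and let $F:K\times K\to\mathbb{R}$ be a monotone bifunction which is skewed $\Delta$-upper semicontinuous, such that $\mathcal{E}(K,F)=\mathcal{E}^{*}(K,F)\neq\varnothing$ and $\operatorname{dom}(J_{\mu F})\supset K$ for all $\mu>0$. Let $(\lambda_k)\subset(0,\infty)$ be bounded away from $0$. Then, for any $x^0\in K$, the sequence generated by the proximal algorithm $$x^{k}:=J_{\lambda_kF}(x^{k-1}),\qquad k\in\mathbb{N},$$ is $\Delta$-convergent to an element of $\mathcal{E}(K,F)$.
   Context: A Hadamard space is a complete CAT(0) space. For $u,v,x,y\in X$ write $\overrightarrow{uv}:=(u,v)$ and $\langle\overrightarrow{uv},\overrightarrow{xy}\rangle := \tfrac12[\rho^2(u,y)+\rho^2(v,x)-\rho^2(u,x)-\rho^2(v,y)]$. $\mathcal{E}(K,F):=\{\bar x\in K: F(\bar x,y)\ge 0\ \forall y\in K\}$ and $\mathcal{E}^{*}(K,F):=\{\bar x\in K: F(y,\bar x)\le 0\ \forall y\in K\}$. $F$ is monotone if $F(x,y)+F(y,x)\le 0$ for all $x,y\in K$. The resolvent of a bifunction $F$ is $J_F:X\rightrightarrows K$, $J_F(x):=\{z\in K: F(z,y)-\langle\overrightarrow{zx},\overrightarrow{zy}\rangle\ge 0\ \forall y\in K\}$, with $\operatorname{dom}(J_F):=\{x\in X:J_F(x)\ne\varnothing\}$; $J_{\mu F}$ is the resolvent of $\mu F$. For monotone $F$, $J_{\mu F}$ is single-valued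 on its domain. For a bounded sequence $(x^k)\subset X$ let $r(x;(x^k)):=\limsup_{k\to\infty}\rho(x,x^k)$; this function of $x$ has a unique minimizer over $X$. A bounded sequence $(x^k)$ is $\Delta$-convergent to $\bar x\in X$ if $\bar x=\operatorname{arg\,min}_{x\in X}r(x;(u^k))$ for every subsequence $(u^k)$ of $(x^k)$. $F$ is skewed $\Delta$-upper semicontinuous if $-F(y,x^{*})\ge\limsup_k F(x^k,y)$ for all $y\in K$, whenever $(x^k)\subset K$ is $\Delta$-convergent to $x^{*}\in K$. *)

(* Defs.v *)
From mathcomp Require Import all_boot all_order all_algebra.
From mathcomp Require Import all_classical all_reals all_analysis.

Set Implicit Arguments.
Unset Strict Implicit.
Unset Printing Implicit Defensive.

Import Order.TTheory GRing.Theory Num.Theory.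

Local Open Scope classical_set_scope.
Local Open Scope ring_scope.

Section Hadamard.
Context {R : realType} {X : metricType R}.

Definition is_geodesic (c : R -> X) (x y : X) : Prop :=
  [/\ c 0 = x, c 1 = y &
      forall s t : R, s \in `[0, 1] -> t \in `[0, 1] ->
        mdist (c s) (c t) = mdist x y * `|s - t|].

(* The library norm on 'rV[R]_2 is the sup norm, so it cannot be used here. *)
Definition edist (a b : 'rV[R]_2) : R :=
  Num.sqrt (\sum_i (a 0 i - b 0 i) ^+ 2).

Definition seg (a b : 'rV[R]_2) (t : R) : 'rV[R]_2 := (1 - t) *: a + t *: b.

(* A geodesic triangle has vertices [v i] and sides [c i] from [v i] to
   [v (i + 1)], with [i : 'I_3] and addition modulo 3; [w] lists the vertices of
   a comparison triangle. Geodesics have constant speed, so the comparison point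
   of [c i s] is the point of parameter [s] on the segment [w i, w (i + 1)]. *)
Definition comparison_ineq : Prop :=
  forall (v : 'I_3 -> X) (c : 'I_3 -> R -> X) (w : 'I_3 -> 'rV[R]_2),
    (forall i, is_geodesic (c i) (v i) (v (i + 1))) ->
    (forall i j, edist (w i) (w j) = mdist (v i) (v j)) ->
    forall i j (s t : R), s \in `[0, 1] -> t \in `[0, 1] ->
      mdist (c i s) (c j t) <=
        edist (seg (w i) (w (i + 1)) s) (seg (w j) (w (j + 1)) t).

Definition geodesic_space : Prop :=
  forall x y : X, exists c, is_geodesic c x y.

Definition cat0 : Prop := geodesic_space /\ comparison_ineq.

Definition complete_metric : Prop :=
  forall u : nat -> X, cauchy (u @ \oo) -> exists l : X, u @ \oo --> l.

Definition hadamard : Prop := complete_metric /\ cat0.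

Definition geodesically_convex (K : set X) : Prop :=
  forall x y c, K x -> K y -> is_geodesic c x y ->
    forall t : R, t \in `[0, 1] -> K (c t).

Definition qlin (u v x y : X) : R :=
  2^-1 * (mdist u y ^+ 2 + mdist v x ^+ 2 - mdist u x ^+ 2 - mdist v y ^+ 2).

Definition bounded_sequence (u : nat -> X) : Prop :=
  exists (a : X) (M : R), forall k, mdist a (u k) <= M.

Definition asymptotic_radius (u : nat -> X) (x : X) : \bar R :=
  limn_esup (fun k => (mdist x (u k))%:E).

Definition argmin (f : X -> \bar R) : set X :=
  [set x | forall y, (f x <= f y)%E].

Definition delta_cvg (u : nat -> X) (x : X) : Prop :=
  bounded_sequence u /\
  forall phi : nat -> nat, increasing_seq phi ->
    argmin (asymptotic_radius (u \o phi)) = [set x].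

(* A bifunction K x K -> R is a total function X -> X -> R; every notion below
   only looks at its values on K x K. *)
Section Bifunction.
Variables (K : set X) (F : X -> X -> R).

Definition equilibria : set X :=
  [set x | K x /\ forall y, K y -> 0 <= F x y].

Definition dual_equilibria : set X :=
  [set x | K x /\ forall y, K y -> F y x <= 0].

Definition monotone_bifun : Prop :=
  forall x y, K x -> K y -> F x y + F y x <= 0.

Definition resolvent (x : X) : set X :=
  [set z | K z /\ forall y, K y -> 0 <= F z y - qlin z x z y].

Definition resolvent_dom : set X := [set x | resolvent x !=set0].

(* The limsup is taken in the extended reals, as F (u k) y may be unbounded. *)
Definition skewed_delta_usc : Prop :=
  forall (u : nat -> X) (x : X), (forall k, K (u k)) -> K x -> delta_cvg u x ->
    forall y, K y -> (limn_esup (fun k => (F (u k) y)%:E) <= (- F y x)%:E)%E.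

End Bifunction.

Definition scale_bifun (mu : R) (F : X -> X -> R) : X -> X -> R :=
  fun x y => mu * F x y.

(* Resolvents of monotone bifunctions are single-valued, so x^k = J(x^(k-1)) is
   rendered as membership; lam 0 is not used. *)
Definition proximal_sequence (K : set X) (F : X -> X -> R) (lam : nat -> R)
    (x : nat -> X) : Prop :=
  forall k, resolvent K (scale_bifun (lam k.+1) F) (x k) (x k.+1).

End Hadamard.

Arguments hadamard {R} X.

(* Main.v *)
(** The CAT(0) inequality makes the squared asymptotic radius of a bounded
    sequence uniformly convex along geodesics, so it has a unique minimizer on
    every closed convex set; constant sequences give metric projections, and a
    diagonal extraction gives Delta-convergent subsequences. Testing the
    resolvent inequality at a point [p] of E(K, F) = E*(K, F) yields
    d(x_{k+1}, p)^2 + d(x_k, x_{k+1})^2 <= d(x_k, p)^2: the sequence is Fejer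
    monotone and its steps tend to 0. Hence liminf F(x_k, y) >= 0 for all [y],
    skewed upper semicontinuity puts every Delta-cluster point in E*(K, F), and
    Opial's argument shows that there is only one. *)

Require Import Defs.
From mathcomp Require Import all_boot all_order all_algebra.
From mathcomp Require Import all_classical all_reals all_analysis.
From mathcomp Require Import ring lra.

Import Order.TTheory GRing.Theory Num.Theory.
Import numFieldNormedType.Exports.

Local Open Scope classical_set_scope.
Local Open Scope ring_scope.

(** * Euclidean comparison triangles and the CAT(0) inequality *)

(* Unqualified [edist] is the extended distance of MathComp-Analysis. *)
Lemma euclid_dist_sqr (R : realType) (a b : 'rV[R]_2) :
  Defs.edist a b ^+ 2 = (a 0 0 - b 0 0) ^+ 2 + (a 0 1 - b 0 1) ^+ 2.
Proof.
rewrite /Defs.edist sqr_sqrtr ?sumr_ge0 // => [|i _]; last exact: sqr_ge0.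
rewrite !big_ord_recr big_ord0 /= add0r.
by congr ((a 0 _ - b 0 _) ^+ 2 + (a 0 _ - b 0 _) ^+ 2); apply: val_inj.
Qed.

Lemma euclid_dist_ge0 (R : realType) (a b : 'rV[R]_2) : 0 <= Defs.edist a b.
Proof. exact: sqrtr_ge0. Qed.

(** Stewart's theorem in the plane. *)
Lemma euclid_dist_seg_sqr (R : realType) (a b w : 'rV[R]_2) (t : R) :
  Defs.edist (seg a b t) w ^+ 2 =
    (1 - t) * Defs.edist a w ^+ 2 + t * Defs.edist b w ^+ 2 -
    t * (1 - t) * Defs.edist a b ^+ 2.
Proof. by rewrite !euclid_dist_sqr /seg !mxE; ring. Qed.

(** The vertices are [(0, 0)], [(a, 0)] and [(p, q)]: the law of cosines dictates [p], and the
    triangle inequalities leave room for [q]. *)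
Lemma comparison_triangle (R : realType) (a b c : R) :
  0 <= a -> 0 <= b -> 0 <= c -> a <= b + c -> b <= a + c -> c <= a + b ->
  exists w0 w1 w2 : 'rV[R]_2,
    [/\ Defs.edist w0 w1 = a, Defs.edist w0 w2 = b & Defs.edist w1 w2 = c].
Proof.
move=> a0 b0 c0 abc bac cab.
pose p := (a ^+ 2 + b ^+ 2 - c ^+ 2) / (2 * a).
have pE : 2 * a * p = a ^+ 2 + b ^+ 2 - c ^+ 2.
  (* If [a = 0], division by zero gives [p = 0], and the equation survives because then [b = c]. *)
  rewrite /p; have [az|anz] := eqVneq a 0; last by field.
  have -> : c = b by lra.
  by rewrite az; ring.
have pb : 0 <= b ^+ 2 - p ^+ 2.
  have [az|anz] := eqVneq a 0.
    by rewrite /p az mulr0 invr0 mulr0 expr0n subr0 sqr_ge0.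
  have a_gt0 : 0 < a by rewrite lt_neqAle eq_sym anz.
  (* Both bounds come from [(a - b) ^+ 2 <= c ^+ 2 <= (a + b) ^+ 2]; cancelling [a] leaves
     [|p| <= b]. *)
  have ap : p * a <= b * a by nra.
  have an : - (b * a) <= p * a by nra.
  have := ler_pM2r a_gt0 p b; have := ler_pM2r a_gt0 (- b) p.
  rewrite mulNr ap an => /esym h1 /esym h2; nra.
pose q := Num.sqrt (b ^+ 2 - p ^+ 2).
have qE : q ^+ 2 = b ^+ 2 - p ^+ 2 by rewrite sqr_sqrtr.
pose pt (s t : R) : 'rV[R]_2 := \row_i (if i == 0 then s else t).
have ptE s t s' t' : Defs.edist (pt s t) (pt s' t') ^+ 2 = (s - s') ^+ 2 + (t - t') ^+ 2.
  by rewrite euclid_dist_sqr !mxE.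
have sqr_inj (u v : R) : 0 <= u -> 0 <= v -> u ^+ 2 = v ^+ 2 -> u = v.
  by move=> u0 v0 /eqP; rewrite eqrXn2// => /eqP.
exists (pt 0 0), (pt a 0), (pt p q).
by split; apply: sqr_inj; rewrite ?euclid_dist_ge0 // ptE; lra.
Qed.

(** The comparison triangle of [x], [y], [z] turns Stewart's identity into an inequality in [X]. *)
Lemma cat0_geodesic_ineq (R : realType) (X : metricType R) (c : R -> X)
    (x y z : X) (t : R) :
  @cat0 R X -> is_geodesic c x y -> t \in `[0, 1] ->
  mdist (c t) z ^+ 2 <=
    (1 - t) * mdist x z ^+ 2 + t * mdist y z ^+ 2 - t * (1 - t) * mdist x y ^+ 2.
Proof.
move=> [geo cmp] cxy t01.
have [c' cyz] := geo y z; have [c'' czx] := geo z x.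
have [||||||w0 [w1 [w2 [e01 e02 e12]]]] :=
  comparison_triangle _ (mdist x y) (mdist x z) (mdist y z);
  rewrite ?mdist_ge0 //.
- by rewrite (metric_sym y z) metric_triangle.
- by rewrite metric_triangle.
- by rewrite (metric_sym x y) metric_triangle.
have esym' (a b : 'rV[R]_2) : Defs.edist a b = Defs.edist b a.
  by rewrite /Defs.edist; congr Num.sqrt; apply: eq_bigr => i _; rewrite -sqrrN opprB.
have exx (a : 'rV[R]_2) : Defs.edist a a = 0.
  by apply/eqP; rewrite -sqrf_eq0 euclid_dist_sqr !subrr expr0n addr0.
(* The point compared with [c t] has parameter [0] on side [2], the geodesic from [z] to [x], so it
   is [z] itself. *)
have := cmp (fun i => nth x [:: x; y; z] i) (fun i => nth c [:: c; c'; c''] i)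
  (fun i => nth w0 [:: w0; w1; w2] i) _ _ 0 2 t 0 t01.
rewrite /= in_itv /= lexx ler01 => /(_ _ _ isT) h.
have {h} : mdist (c t) (c'' 0) <= Defs.edist (seg w0 w1 t) (seg w2 w0 0).
  apply: h => [[[|[|[|//]]] ?]|[[|[|[|//]]] ?] [[|[|[|//]]] ?]] //=;
    by rewrite ?mdistxx ?exx // ?e01 ?e02 ?e12 // esym' ?e01 ?e02 ?e12 metric_sym.
case: czx => -> _ _; rewrite {2}/seg subr0 scale1r scale0r addr0 => h.
by rewrite -e01 -e02 -e12 -euclid_dist_seg_sqr lerXn2r // nnegrE ?mdist_ge0 ?euclid_dist_ge0.
Qed.

(** * The asymptotic radius and its minimizers on convex sets *)

(** Trades the limit superior for eventual bounds with a slack [e], the form in which it is handled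
    below. *)
Lemma limn_esup_leP (R : realType) (v : nat -> R) (l : R) :
  (limn_esup (fun k => (v k)%:E) <= l%:E)%E <->
  (forall e, 0 < e -> \forall k \near \oo, v k <= l + e).
Proof.
split=> [vl e e0|vl].
  have : (limn_esup (fun k => (v k)%:E) < (l + e)%:E)%E.
    by apply: le_lt_trans vl _; rewrite lte_fin ltrDl.
  move=> /ereal_inf_lt[_ [V VF <-] Vl].
  apply: filterS VF => k Vk; rewrite -lee_fin (le_trans _ (ltW Vl)) //.
  by apply: ereal_sup_ubound; exists k.
apply/lee_addgt0Pr => e e0; rewrite -EFinD.
apply: ge_ereal_inf; exists (ereal_sup ((fun k => (v k)%:E) @` [set k | v k <= l + e])).
  by exists [set k | v k <= l + e] => //; exact: vl.
by apply: ge_ereal_sup => _ [k vk <-]; rewrite lee_fin.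
Qed.

Section AsymptoticRadius.
Context {R : realType} {X : metricType R}.
Implicit Types (u : nat -> X) (x y : X) (l B : R).

Definition asymp_rad u x : R := fine (asymptotic_radius u x).

Lemma bounded_sequence_dist u x :
  bounded_sequence u -> exists M, forall k, mdist x (u k) <= M.
Proof.
move=> [a [M uM]]; exists (mdist x a + M) => k.
by rewrite (le_trans (metric_triangle x a _)) // lerD2l.
Qed.

Lemma asymptotic_radiusE u x :
  bounded_sequence u -> asymptotic_radius u x = (asymp_rad u x)%:E.
Proof.
move=> /(bounded_sequence_dist _ x)[M uM]; rewrite /asymp_rad fineK //.
have rM : (asymptotic_radius u x <= M%:E)%E.
  apply/limn_esup_leP => e e0; near=> k.
  by rewrite (le_trans (uM k)) // lerDl ltW.
rewrite fin_numE -ltey (le_lt_trans rM (ltry _)) andbT -ltNye.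
(* A radius below [-1] would make distances eventually at most [-1/2], so the radius is not
   [-oo]. *)
rewrite (lt_le_trans (ltNyr (- 1))) // leNgt; apply/negP => r1.
have /limn_esup_leP/(_ 2^-1) := ltW r1; rewrite invr_gt0 ltr0n => /(_ isT)[N _ /(_ N (leqnn N))/=].
have := mdist_ge0 x (u N); lra.
Unshelve. all: by end_near. Qed.

Lemma asymp_rad_leP u x l : bounded_sequence u ->
  asymp_rad u x <= l <-> forall e, 0 < e -> \forall k \near \oo, mdist x (u k) <= l + e.
Proof.
by move=> bu; rewrite -lee_fin -asymptotic_radiusE //; exact: limn_esup_leP.
Qed.

Lemma asymp_rad_near u x e : bounded_sequence u -> 0 < e ->
  \forall k \near \oo, mdist x (u k) <= asymp_rad u x + e.
Proof. by move=> bu; exact: (asymp_rad_leP _ _ _ bu).1. Qed.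

Lemma asymp_rad_ge0 u x : bounded_sequence u -> 0 <= asymp_rad u x.
Proof.
move=> bu; apply/ler_addgt0Pr => e e0.
have [N _ /(_ N (leqnn N))/=] := asymp_rad_near u x e bu e0.
exact: le_trans (mdist_ge0 _ _).
Qed.

Lemma asymp_rad_le u v x y : bounded_sequence u -> bounded_sequence v ->
  (\forall k \near \oo, mdist x (u k) <= mdist y (v k)) -> asymp_rad u x <= asymp_rad v y.
Proof.
move=> bu bv uv; apply/asymp_rad_leP => // e e0.
near=> k; apply: (@le_trans _ _ (mdist y (v k))); first by near: k.
by near: k; exact: asymp_rad_near.
Unshelve. all: by end_near. Qed.

Lemma asymp_rad_lipschitz u x y : bounded_sequence u ->
  asymp_rad u x <= mdist x y + asymp_rad u y.
Proof.
move=> bu; apply/asymp_rad_leP => // e e0; near=> k.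
rewrite (le_trans (metric_triangle x y _)) // -addrA lerD2l.
by near: k; exact: asymp_rad_near.
Unshelve. all: by end_near. Qed.

(** The CAT(0) estimates concern squared distances; they pass to the radius through
    [Num.sqrt (B + e)]. *)
Lemma asymp_rad_sqr_le u x B : bounded_sequence u ->
  (forall e, 0 < e -> \forall k \near \oo, mdist x (u k) ^+ 2 <= B + e) ->
  asymp_rad u x ^+ 2 <= B.
Proof.
move=> bu uB; apply/ler_addgt0Pr => e e0.
have Be0 : 0 <= B + e.
  have [N _ /(_ N (leqnn N))/=] := uB e e0; exact: le_trans (sqr_ge0 _).
rewrite -[leRHS]sqr_sqrtr // lerXn2r ?nnegrE ?asymp_rad_ge0 ?sqrtr_ge0 //.
apply/asymp_rad_leP => // d d0; near=> k.
apply: (@le_trans _ _ (Num.sqrt (B + e))); last by rewrite lerDl ltW.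
rewrite -(@ler_pXn2r _ 2) ?nnegrE ?mdist_ge0 ?sqrtr_ge0 // sqr_sqrtr //.
by near: k; exact: uB.
Unshelve. all: by end_near. Qed.

Lemma asymp_rad_cst a x : asymp_rad (fun=> a) x = mdist x a.
Proof.
have ba : bounded_sequence (fun=> a) by exists a, 0 => _; rewrite mdistxx.
apply/eqP; rewrite eq_le; apply/andP; split.
  by apply/asymp_rad_leP => // e e0; near=> k; rewrite lerDl ltW.
apply/ler_addgt0Pr => e e0.
by have [N _ /(_ N (leqnn N))] := asymp_rad_near (fun=> a) x e ba e0.
Unshelve. all: by end_near. Qed.

Lemma asymp_rad_geodesic_ineq u c x y (t : R) :
  @cat0 R X -> bounded_sequence u -> is_geodesic c x y -> t \in `[0, 1] ->
  asymp_rad u (c t) ^+ 2 <=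
    (1 - t) * asymp_rad u x ^+ 2 + t * asymp_rad u y ^+ 2 - t * (1 - t) * mdist x y ^+ 2.
Proof.
move=> cat bu cxy t01; apply: asymp_rad_sqr_le => // e e0.
have [rx0 ry0] := (asymp_rad_ge0 u x bu, asymp_rad_ge0 u y bu).
set rx := asymp_rad u x in rx0 *; set ry := asymp_rad u y in ry0 *.
(* With this [d], [(r + d) ^+ 2 <= r ^+ 2 + e] whenever [0 <= r <= rx + ry]. *)
pose d := Num.min 1 (e / (2 * (rx + ry) + 1)).
have S0 : 0 < 2 * (rx + ry) + 1 by lra.
have d0 : 0 < d by rewrite lt_min ltr01 divr_gt0.
have d1 : d <= 1 by rewrite ge_min lexx.
have dS : d * (2 * (rx + ry) + 1) <= e.
  by rewrite -ler_pdivlMr // ge_min lexx orbT.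
have sq r : 0 <= r -> r <= rx + ry -> (r + d) ^+ 2 <= r ^+ 2 + e by nra.
near=> k.
have xk : mdist x (u k) ^+ 2 <= rx ^+ 2 + e.
  apply: le_trans (sq _ rx0 _); last by lra.
  rewrite lerXn2r ?nnegrE ?mdist_ge0 // ?addr_ge0 ?(ltW d0) //.
  by near: k; exact: asymp_rad_near.
have yk : mdist y (u k) ^+ 2 <= ry ^+ 2 + e.
  apply: le_trans (sq _ ry0 _); last by lra.
  rewrite lerXn2r ?nnegrE ?mdist_ge0 // ?addr_ge0 ?(ltW d0) //.
  by near: k; exact: asymp_rad_near.
apply: le_trans (cat0_geodesic_ineq _ _ c x y (u k) t cat cxy t01) _.
move: t01; rewrite in_itv /= => /andP[t0 t1]; nra.
Unshelve. all: by end_near. Qed.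

(** A minimizing sequence is Cauchy by convexity at midpoints. Its limit has quadratic growth, since
    a violation at [y] would put a point of the geodesic from [p] to [y] below the infimum. *)
Lemma asymp_rad_projection u (C : set X) :
  hadamard X -> bounded_sequence u ->
  C !=set0 -> closed C -> geodesically_convex C ->
  exists2 p, C p &
    forall y, C y -> asymp_rad u p ^+ 2 + mdist p y ^+ 2 <= asymp_rad u y ^+ 2.
Proof.
move=> [complX catX] bu [x0 Cx0] Ccl Ccvx.
pose f x := asymp_rad u x ^+ 2.
have f0 x : 0 <= f x by exact: sqr_ge0.
have fS : has_inf (f @` C).
  by split; [exists (f x0), x0 | exists 0 => _ [x _ <-]].
pose m := inf (f @` C).
have mf x : C x -> m <= f x.
  by move=> Cx; apply: ge_inf; [exact: fS.2|exists x].
have midC c x y t : C x -> C y -> is_geodesic c x y -> t \in `[0, 1] ->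
    m <= (1 - t) * f x + t * f y - t * (1 - t) * mdist x y ^+ 2.
  move=> Cx Cy cxy t01; apply: le_trans (asymp_rad_geodesic_ineq _ _ _ _ _ catX bu cxy t01).
  by apply: mf; exact: Ccvx cxy _ t01.
have /choice[s sP] (n : nat) : exists x, C x /\ f x < m + n.+1%:R^-1.
  have n0 : 0 < n.+1%:R^-1 :> R by rewrite invr_gt0.
  by have [_ [x Cx <-] fx] := inf_adherent n0 fS; exists x.
have near_s (e : R) : 0 < e -> \forall n \near \oo, f (s n) <= m + e.
  move=> e0; near=> n; apply/ltW/(lt_trans (sP n).2); rewrite ltrD2l.
  by near: n; exact: near_infty_natSinv_lt (PosNum e0).
have half01 : (2^-1 : R) \in `[0, 1] by rewrite in_itv /=; lra.
have [p sp] : exists q : X, s @ \oo --> q.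
  apply: (complX s); apply/cauchy_ballP => e e0.
  (* At the midpoint, values within [e ^+ 2 / 8] of [m] force the squared distance down to
     [e ^+ 2 / 2]. *)
  have e4 : 0 < e ^+ 2 / 8 by rewrite divr_gt0 // exprn_gt0.
  rewrite near_map2; near=> i j; rewrite ballEmdist /=.
  have [c cij] := catX.1 (s i) (s j).
  have := midC _ _ _ _ (sP i).1 (sP j).1 cij half01.
  have fi : f (s i) <= m + e ^+ 2 / 8 by near: i; exact: near_s.
  have fj : f (s j) <= m + e ^+ 2 / 8 by near: j; exact: near_s.
  move=> h; rewrite -(@ltr_pXn2r _ 2) ?nnegrE ?mdist_ge0 ?(ltW e0) //; lra.
have sp' := metricType_numDomainType.cvgr_dist_lt sp.
have Cp : C p by apply: (closed_cvg _ Ccl _ _ sp); near=> n; exact: (sP n).1.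
have fp : f p = m.
  apply/eqP; rewrite eq_le mf // andbT /f.
  have m0 : 0 <= m by apply: lb_le_inf => [|_ [x _ <-]]; [exists (f x0), x0|].
  rewrite -[leRHS]sqr_sqrtr // lerXn2r ?nnegrE ?asymp_rad_ge0 ?sqrtr_ge0 //.
  apply/ler_addgt0Pr => e e0.
  have e2 : 0 < e / 2 by rewrite divr_gt0.
  near \oo => n.
  have pn : mdist p (s n) < e / 2 by near: n; exact: sp'.
  have fn : f (s n) <= m + (e / 2) ^+ 2.
    by near: n; apply: near_s; rewrite exprn_gt0.
  have rn : asymp_rad u (s n) <= Num.sqrt m + e / 2.
    have := sqr_sqrtr m0; have := sqrtr_ge0 m => q0 qE.
    rewrite -(@ler_pXn2r _ 2) ?nnegrE ?asymp_rad_ge0 ?addr_ge0 ?(ltW e2) //.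
    apply: le_trans fn _; rewrite -{1}qE; nra.
  by have := asymp_rad_lipschitz u p (s n) bu; lra.
exists p => // y Cy; rewrite -!/(f _) leNgt; apply/negP => lty.
have [c cpy] := catX.1 p y.
have mfy := mf y Cy.
set D := mdist p y ^+ 2 in lty *.
(* [dl] is the defect of the claimed inequality. Convexity at parameter [t], divided by [t], yields
   [dl <= t * D], whereas the choice of [t] makes [t * D] equal to [dl / 2]. *)
pose dl := m + D - f y.
have dl0 : 0 < dl by rewrite /dl -fp; lra.
have D0 : 0 < D by rewrite /dl in dl0; lra.
pose t := dl / (2 * D).
have tD : t * (2 * D) = dl by rewrite /t divfK // mulf_neq0 ?gt_eqF.
have t0 : 0 < t by rewrite divr_gt0 // mulr_gt0.
have t1 : t <= 1 by rewrite /dl in tD; nra.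
have := midC _ _ _ t Cp Cy cpy; rewrite in_itv /= (ltW t0) t1 => /(_ isT).
rewrite fp -/D => h.
have : t * (f y - m - (1 - t) * D) >= 0 by lra.
rewrite pmulr_rge0 // /dl in tD * => h2; nra.
Unshelve. all: by end_near. Qed.

End AsymptoticRadius.

(** * Diagonal extraction of subsequences *)

Lemma increasing_seq_comp (f g : nat -> nat) :
  increasing_seq f -> increasing_seq g -> increasing_seq (f \o g).
Proof. by move=> fi gi m n; rewrite /= fi; exact: gi. Qed.

Lemma increasing_seq_ge (f : nat -> nat) : increasing_seq f -> forall n, (n <= f n)%N.
Proof.
move=> /increasing_seqP fi; elim=> // n IH; exact: leq_ltn_trans IH (fi n).
Qed.

(* [phi n.+1] almost minimizes [rho] among the subsequences of [phi n], and a
   subsequence of the diagonal is eventually a subsequence of each [phi n]. *)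
Lemma diagonal_subsequence (R : realType) (rho : (nat -> nat) -> R) :
  (forall phi, 0 <= rho phi) ->
  (forall phi theta : nat -> nat, increasing_seq theta -> rho (phi \o theta) <= rho phi) ->
  (forall phi n, rho phi <= rho (fun k => phi (k + n)%N)) ->
  exists2 delta, increasing_seq delta &
    forall psi, increasing_seq psi -> rho (delta \o psi) = rho delta.
Proof.
move=> rho0 rho_sub rho_shift.
have /choice[nxt nxtP] (a : nat * (nat -> nat)) : exists theta, increasing_seq theta /\
    forall theta', increasing_seq theta' ->
      rho (a.2 \o theta) <= rho (a.2 \o theta') + a.1.+1%:R^-1.
  pose I : set (nat -> nat) := fun theta => increasing_seq theta.
  pose S := (fun theta : nat -> nat => rho (a.2 \o theta)) @` I.
  have infS : has_inf S.
    by split; [exists (rho (a.2 \o id)), id | exists 0 => _ [th _ <-]].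
  have a0 : 0 < a.1.+1%:R^-1 :> R by rewrite invr_gt0.
  have [_ [th thi <-] thS] := inf_adherent a0 infS.
  exists th; split=> // th' th'i; apply: (le_trans (ltW thS)); rewrite lerD2r.
  by apply: ge_inf; [exact: infS.2 | exists th'].
pose fix phi n := if n is n'.+1 then phi n' \o nxt (n', phi n') else id.
have phi_incr n : increasing_seq (phi n).
  by elim: n => [|n IH] //; apply: increasing_seq_comp IH (nxtP _).1.
pose delta n := phi n n.
have delta_incr : increasing_seq delta.
  apply/increasing_seqP => n; rewrite /delta /=.
  rewrite ltEnat /=; have /leqW_mono-> := phi_incr n.
  exact: increasing_seq_ge (nxtP _).1 n.+1.
have delta_sub n k : (n <= k)%N -> exists j, delta k = phi n j.
  suff chain i : (n <= k)%N -> exists j, phi k i = phi n j by exact: chain.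
  elim: k i => [|k IH] i.
    by rewrite leqn0 => /eqP->; exists i.
  rewrite leq_eqVlt => /predU1P[->|nk]; first by exists i.
  exact: IH nk.
exists delta => // psi psi_incr; apply/eqP; rewrite eq_le rho_sub //=.
apply/ler_addgt0Pr => e e0.
have [n ne] : exists n, n.+1%:R^-1 <= e.
  have [N _ /(_ N (leqnn N))/ltW NP] := near_infty_natSinv_lt (PosNum e0).
  by exists N.
(* The shift by [m] makes every index [chi (k + m)] at least [m], where [delta] takes its values in
   the range of [phi m]. *)
have tail (chi : nat -> nat) m : increasing_seq chi ->
    exists2 theta, increasing_seq theta &
      (fun k => delta (chi (k + m)%N)) = phi m \o theta.
  move=> chi_incr.
  have /choice[theta thetaP] (k : nat) : exists j, delta (chi (k + m)%N) = phi m j.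
    apply: delta_sub; apply: leq_trans (increasing_seq_ge _ chi_incr _).
    exact: leq_addl.
  exists theta; last by apply/funext.
  (* [phi m] reflects the order, so the pointwise choice [theta] is increasing. *)
  move=> i j; rewrite -[LHS](phi_incr m) -!thetaP delta_incr.
  by rewrite [LHS]chi_incr leq_add2r.
have [th thi thE] := tail id n.+1 (fun _ _ => erefl).
have [th' th'i th'E] := tail psi n psi_incr.
(* [rho delta <= rho (phi n.+1)], which exceeds [rho (phi n \o th') <= rho (delta \o psi)] by at
   most [n.+1%:R^-1]. *)
apply: (le_trans (rho_shift delta n.+1)); rewrite thE.
apply: (le_trans (rho_sub _ _ thi)).
apply: (le_trans ((nxtP (n, phi n)).2 th' th'i)) => /=.
apply: lerD ne; rewrite -th'E.
exact: (rho_sub (delta \o psi) (fun k => (k + n)%N) (fun i j => leq_add2r n i j)).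
Qed.

(** * Asymptotic centers and Delta-convergence *)

Section AsymptoticCenter.
Context {R : realType} {X : metricType R}.
Implicit Types (u : nat -> X) (a x y : X).

Lemma bounded_subsequence u (phi : nat -> nat) :
  bounded_sequence u -> bounded_sequence (u \o phi).
Proof. by move=> [a [M uM]]; exists a, M => k; exact: uM. Qed.

Lemma asymptotic_center u : hadamard X -> bounded_sequence u ->
  exists a, forall y, asymp_rad u a ^+ 2 + mdist a y ^+ 2 <= asymp_rad u y ^+ 2.
Proof.
move=> hX bu; have [|||a _ aP] := asymp_rad_projection u setT hX bu.
- by exists (u 0%N).
- exact: closedT.
- by [].
by exists a => y; exact: aP.
Qed.

(** Quadratic growth around the center [c] forces every minimizer to equal [c]. *)
Lemma asymp_rad_min_unique u a y : hadamard X -> bounded_sequence u ->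
  (forall z, asymp_rad u a <= asymp_rad u z) -> asymp_rad u y <= asymp_rad u a -> y = a.
Proof.
move=> hX bu amin ya; have [c cP] := asymptotic_center u hX bu.
suff ec z : asymp_rad u z <= asymp_rad u a -> c = z by rewrite -(ec y ya) -(ec a).
move=> za; apply: mdist_positivity; apply/eqP; rewrite -sqrf_eq0.
have := le_trans za (amin c); have := cP z.
have := asymp_rad_ge0 u z bu; have := asymp_rad_ge0 u c bu.
rewrite eq_le sqr_ge0 andbT; nra.
Qed.

Lemma argmin_asymptotic_radius u a : hadamard X -> bounded_sequence u ->
  (forall z, asymp_rad u a <= asymp_rad u z) -> argmin (asymptotic_radius u) = [set a].
Proof.
move=> hX bu amin; apply/seteqP; split=> [y yP|_ -> z].
  apply: asymp_rad_min_unique amin _ => //.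
  by have := yP a; rewrite !asymptotic_radiusE // lee_fin.
by rewrite !asymptotic_radiusE // lee_fin.
Qed.

Lemma delta_cvg_min u a : delta_cvg u a -> forall z, asymp_rad u a <= asymp_rad u z.
Proof.
move=> [bu /(_ id (fun _ _ => erefl)) ua] z.
have : argmin (asymptotic_radius (u \o id)) a by rewrite ua.
by move=> /(_ z); rewrite !asymptotic_radiusE // lee_fin.
Qed.

(** Skewed upper semicontinuity only concerns limits in [K]; this supplies the membership for
    Delta-limits. *)
Lemma asymptotic_center_mem u a (K : set X) :
  hadamard X -> bounded_sequence u -> closed K -> geodesically_convex K ->
  (forall k, K (u k)) -> (forall z, asymp_rad u a <= asymp_rad u z) -> K a.
Proof.
move=> hX bu Kcl Kcvx Ku amin.
have ba : bounded_sequence (fun=> a) by exists a, 0 => _; rewrite mdistxx.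
(* The projection of [a] to [K] is at least as close to every [u k] as [a]. *)
have [|||p Kp pP] := asymp_rad_projection (fun=> a) K hX ba; rewrite //.
  by exists (u 0%N).
suff <- : p = a by [].
apply: (asymp_rad_min_unique u a p hX bu amin); apply: asymp_rad_le => //; near=> k.
have := pP _ (Ku k); rewrite !asymp_rad_cst => h.
rewrite -(@ler_pXn2r _ 2) ?nnegrE ?mdist_ge0 // (metric_sym a).
by apply: le_trans h; rewrite lerDr sqr_ge0.
Unshelve. all: by end_near. Qed.

Lemma asymp_rad_subsequence u (phi : nat -> nat) x : bounded_sequence u ->
  increasing_seq phi -> asymp_rad (u \o phi) x <= asymp_rad u x.
Proof.
move=> bu phii; apply/asymp_rad_leP; first exact: bounded_subsequence.
move=> e e0; have [N _ NP] := asymp_rad_near u x e bu e0.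
exists N => // k /= Nk; apply: NP => /=.
exact: leq_trans Nk (increasing_seq_ge _ phii k).
Qed.

(** [diagonal_subsequence] is applied to the minimal radius. Once all further subsequences share its
    value, the center of [u \o phi] is minimal for each of them. *)
Lemma delta_cvg_subsequence u : hadamard X -> bounded_sequence u ->
  exists2 phi, increasing_seq phi & exists a, delta_cvg (u \o phi) a.
Proof.
move=> hX bu.
have bsub phi := bounded_subsequence u phi bu.
have /choice[ctr ctrP] (phi : nat -> nat) : exists a, forall y,
    asymp_rad (u \o phi) a <= asymp_rad (u \o phi) y.
  have [a aP] := asymptotic_center (u \o phi) hX (bsub phi).
  exists a => y; rewrite -(@ler_pXn2r _ 2) ?nnegrE ?asymp_rad_ge0 //.
  by apply: le_trans (aP y); rewrite lerDl sqr_ge0.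
have [||| phi phii phiP] :=
  diagonal_subsequence _ (fun phi => asymp_rad (u \o phi) (ctr phi)).
- by move=> phi; exact: asymp_rad_ge0.
- move=> phi th thi; apply: le_trans (ctrP _ (ctr phi)) _.
  exact: asymp_rad_subsequence (bsub phi) thi.
- move=> phi n; apply: le_trans (ctrP _ (ctr (fun k => phi (k + n)%N))) _.
  apply/asymp_rad_leP => // e e0.
  have [N _ NP] := asymp_rad_near _ (ctr (fun k => phi (k + n)%N)) e
    (bsub (fun k => phi (k + n)%N)) e0.
  (* Index [k] of [phi] is index [k - n] of the shifted sequence. *)
  exists (N + n)%N => // k /= Nk.
  have nk : (n <= k)%N := leq_trans (leq_addl N n) Nk.
  have /NP/= : (N <= k - n)%N by rewrite leq_subRL // addnC.
  by rewrite subnK.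
exists phi => //; exists (ctr phi); split=> // psi psii.
apply: argmin_asymptotic_radius => // [|z]; first exact: bsub.
apply: (le_trans (asymp_rad_subsequence _ _ _ (bsub phi) psii)).
by rewrite -(phiP psi psii); exact: ctrP.
Qed.

(* Opial's argument: distances to points of [E] have limits along the whole
   sequence, so Delta-limits of two subsequences minimize the same radius. *)
Lemma fejer_delta_cvg u (E : set X) : hadamard X ->
  bounded_sequence u ->
  (forall p k, E p -> mdist (u k.+1) p <= mdist (u k) p) ->
  (forall phi a, increasing_seq phi -> delta_cvg (u \o phi) a -> E a) ->
  exists2 a, E a & delta_cvg u a.
Proof.
move=> hX bu fejer cluster.
have bsub phi := bounded_subsequence u phi bu.
(* By monotonicity, the distance at the single index [phi N] bounds all later ones, so passing to a
   subsequence keeps the radius at points of [E]. *)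
have radE p phi : E p -> increasing_seq phi -> asymp_rad (u \o phi) p = asymp_rad u p.
  move=> Ep phii; apply/eqP; rewrite eq_le asymp_rad_subsequence //=.
  apply/asymp_rad_leP => // e e0.
  have [N _ /(_ N (leqnn N)) /= NP] := asymp_rad_near _ p e (bsub phi) e0.
  exists (phi N) => // k /= Nk; apply: le_trans NP.
  rewrite !(metric_sym p).
  have : {homo (fun k => mdist (u k) p) : i j / (i <= j)%N >-> j <= i}.
    by apply/nonincreasing_seqP => i; exact: fejer.
  exact.
have [phi phii [a uphia]] := delta_cvg_subsequence u hX bu.
have Ea := cluster _ _ phii uphia.
exists a => //; split=> // psi psii.
have [th thi [b ub]] := delta_cvg_subsequence _ hX (bsub psi).
have pti := increasing_seq_comp _ _ psii thi.
have Eb : E b by exact: cluster pti ub.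
(* Both points lie in [E], where radii along subsequences agree with those along [u]; minimality of
   [b] thus makes it as good as [a] for [u \o phi]. *)
have ba : b = a.
  apply: (asymp_rad_min_unique (u \o phi)) => //; first exact: delta_cvg_min.
  rewrite !radE // -(radE b _ Eb pti) -(radE a _ Ea pti).
  exact: delta_cvg_min ub a.
rewrite ba in ub; apply: argmin_asymptotic_radius => // z.
rewrite radE // -(radE a _ Ea pti).
apply: le_trans (delta_cvg_min _ _ ub z) _.
exact: asymp_rad_subsequence thi.
Qed.

End AsymptoticCenter.

(** * Estimates for the proximal sequence and its convergence *)

(** The resolvent and triangle inequalities bound [lam k.+1 * F (x k.+1) y] below by [- (mdist (x k)
    (x k.+1) * mdist (x k.+1) y)], which tends to [0]; dividing is safe because [c <= lam k.+1]. *)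
Lemma proximal_sequence_eventually_ge (R : realType) (X : metricType R) (K : set X)
    (F : X -> X -> R) (lam : nat -> R) (x : nat -> X) (c : R) :
  0 < c -> (forall k, c <= lam k.+1) -> bounded_sequence x ->
  mdist (x k) (x k.+1) @[k --> \oo] --> 0 ->
  proximal_sequence K F lam x -> forall y, K y ->
  forall e, 0 < e -> \forall k \near \oo, - e <= F (x k) y.
Proof.
move=> c0 clam bx dx prox y Ky e e0.
have [M xM] := bounded_sequence_dist x y bx.
have M0 : 0 <= M := le_trans (mdist_ge0 _ _) (xM 0%N).
have dl0 : 0 < e * c / (M + 1) by rewrite divr_gt0 ?mulr_gt0 // ltr_wpDl.
have [N _ NP] : \forall k \near \oo, mdist (x k) (x k.+1) < e * c / (M + 1).
  by apply: (cvgr_lt _ dx).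
(* A short step from [x k] controls [F] at [x k.+1], hence the shift to [N.+1]. *)
exists N.+1 => // -[//|k] /= /NP; rewrite ltr_pdivlMr ?ltr_wpDl // => dk.
have := (prox k).2 y Ky; rewrite /scale_bifun /qlin mdistxx expr0n subr0.
have l0 : 0 < lam k.+1 := lt_le_trans c0 (clam k).
have := clam k; have := metric_triangle (x k) (x k.+1) y.
have := mdist_ge0 (x k) (x k.+1).
have := mdist_ge0 (x k.+1) y; have := mdist_ge0 (x k) y.
have := xM k; have := xM k.+1; rewrite !(metric_sym y).
move: (mdist (x k) y) (mdist (x k.+1) y) (mdist (x k) (x k.+1)) (lam k.+1)
  (F (x k.+1) y) l0 dk => A B d l f l0 dk BM AM A0 B0 d0 tri cl h.
have lf : - (d * M) <= l * f by nra.
rewrite leNgt; apply/negP => fe.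
have : l * f < - (l * e) by nra.
nra.
Qed.

(** Since [F z p <= 0], the resolvent inequality tested at [p] forces [qlin z x z p <= 0], which
    expands to the claim. *)
Lemma resolvent_dual_equilibrium (R : realType) (X : metricType R) (K : set X)
    (F : X -> X -> R) (mu : R) (x z p : X) :
  0 < mu -> resolvent K (scale_bifun mu F) x z -> dual_equilibria K F p ->
  mdist z p ^+ 2 + mdist x z ^+ 2 <= mdist x p ^+ 2.
Proof.
move=> mu0 [Kz zP] [Kp pP]; have := zP p Kp; have := pP z Kz.
rewrite /scale_bifun /qlin mdistxx expr0n subr0; nra.
Qed.

(** Squared steps are at most the consecutive differences of a nonincreasing nonnegative, hence
    convergent, sequence. *)
Lemma proximal_step_cvg0 (R : realType) (X : metricType R) (x : nat -> X) (p : X) :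
  (forall k, mdist (x k.+1) p ^+ 2 + mdist (x k) (x k.+1) ^+ 2 <= mdist (x k) p ^+ 2) ->
  mdist (x k) (x k.+1) @[k --> \oo] --> 0.
Proof.
move=> xP; pose v k := mdist (x k) p ^+ 2.
have vcv : cvgn v.
  apply: nonincreasing_is_cvgn.
    by apply/nonincreasing_seqP => k; apply: le_trans (xP k); rewrite lerDl sqr_ge0.
  by exists 0 => _ [k _ <-]; exact: sqr_ge0.
have dv : v k - v k.+1 @[k --> \oo] --> 0.
  rewrite -[X in _ --> X](subrr (limn v)); apply: cvgB => //.
  by rewrite cvg_shiftS.
apply/cvgr0Pnorm_lt => e e0; near=> k.
rewrite ger0_norm ?mdist_ge0 // -(@ltr_pXn2r _ 2) ?nnegrE ?mdist_ge0 ?(ltW e0) //.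
apply: (@le_lt_trans _ _ (v k - v k.+1)); first by rewrite lerBrDl xP.
by near: k; apply: (cvgr_lt _ dv); rewrite exprn_gt0.
Unshelve. all: by end_near. Qed.

Theorem theorem7p7 (R : realType) (X : metricType R) (K : set X)
    (F : X -> X -> R) (lam : nat -> R) (x : nat -> X) :
  hadamard X ->
  K !=set0 -> closed K -> geodesically_convex K ->
  monotone_bifun K F ->
  skewed_delta_usc K F ->
  equilibria K F = dual_equilibria K F ->
  equilibria K F !=set0 ->
  (forall mu : R, 0 < mu -> K `<=` resolvent_dom K (scale_bifun mu F)) ->
  (forall k, 0 < lam k.+1) ->
  (exists2 c : R, 0 < c & forall k, c <= lam k.+1) ->
  K (x 0%N) ->
  proximal_sequence K F lam x ->
  exists2 xbar : X, equilibria K F xbar & delta_cvg x xbar.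
Proof.
move=> hX _ Kcl Kcvx _ usc EE [p0 Ep0] _ lam0 [c c0 clam] Kx0 prox.
have Kx k : K (x k) by case: k => [//|k]; exact: (prox k).1.
have step p k : equilibria K F p ->
    mdist (x k.+1) p ^+ 2 + mdist (x k) (x k.+1) ^+ 2 <= mdist (x k) p ^+ 2.
  by rewrite EE; exact: resolvent_dual_equilibrium (lam0 k) (prox k).
have fejer p k : equilibria K F p -> mdist (x k.+1) p <= mdist (x k) p.
  move=> Ep; rewrite -(@ler_pXn2r _ 2) ?nnegrE ?mdist_ge0 //.
  by apply: le_trans (step p k Ep); rewrite lerDl sqr_ge0.
have bx : bounded_sequence x.
  exists p0, (mdist (x 0%N) p0) => k; rewrite metric_sym.
  by elim: k => // k; apply: le_trans; exact: fejer.
have dx := proximal_step_cvg0 _ _ x p0 (fun k => step p0 k Ep0).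
apply: fejer_delta_cvg => // phi a phii xa.
have Ka : K a.
  apply: (asymptotic_center_mem (x \o phi)) => // [|k|]; first exact: bounded_subsequence.
    exact: Kx.
  exact: delta_cvg_min.
rewrite EE; split=> // y Ky; rewrite leNgt; apply/negP => Fya.
(* With this slack, semicontinuity eventually gives [F (x (phi k)) y <= - 3/4 * F y a], against the
   eventual lower bound [- (F y a / 4)]. *)
have e0 : 0 < F y a / 4 by rewrite divr_gt0.
have /limn_esup_leP/(_ _ e0)[N _ NP] := usc _ _ (fun k => Kx (phi k)) Ka xa y Ky.
have [M _ MP] := proximal_sequence_eventually_ge _ _ _ _ _ _ _ c0 clam bx dx prox _ Ky _ e0.
have := NP (maxn N M) (leq_maxl _ _).
have /MP/= : (M <= phi (maxn N M))%N.
  exact: leq_trans (leq_maxr N M) (increasing_seq_ge _ phii _).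
lra.
Qed.
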